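(* Let $R_1,\dots,R_t$ be commutative rings. If $R_j$ is a ring with representations for all $j=1,\dots,t$, then $R=R_1\times\cdots\times R_t$ is a ring with representations.
   Context: All rings are commutative with unit and ring morphisms preserve the unit. Kernel of a pair: for $R$-linear maps (or matrices over $R[z]$) $f_1:M_1\to N$ and $f_2:M_2\to N$, put $\mathrm{Ker}(f_1\mid f_2):=\{m_2\in M_2 : \exists m_1\in M_1,\ f_1(m_1)+f_2(m_2)=0\}$. Convolutional codes: for $k\le n$, an $(n,k)$ convolutional code (equivalently, an $(n,k)$ family of convolutional codes) over $R$ is a free $R[z]$-submodule $\mathfrak{C}\subset R[z]^n$ of rank $k$ such that $R[z]^n/\mathfrak{C}$ is flat over $R$. For a prime $\mathfrak{p}$ of $R$ with residue field $k(\mathfrak{p})$, $\mathfrak{C}(\mathfrak{p}):=\mathfrak{C}\otimes_R k(\mathfrak{p})$ is then a rank $k$ submodule of $k(\mathfrak{p})[z]^n$; its degree is the highest degree of the $k\times k$ minors of any $n\times k$ matrix over $k(\mathfrak{p})[z]$ whose columns generate $\mathfrak{C}(\mathfrak{p})$. The degree of $\mathfrak{C}$ is the function $\mathrm{Spec}(R)\to\mathbb{N}$, $\mathfrak{p}\mapsto \deg\mathfrak{C}(\mathfrak{p})$. Standing assumption: all codes considered have constant degree function, with value denoted $\delta$. First order representations: a first order representation of an $(n,k)$ code $\mathfrak{C}$ of degree $\delta$ over $R$ is a triple $(K,L,M)$ with $K,L\in \mathrm{Mat}_{(\delta+n-k)\times\delta}(R)$, $M\in \mathrm{Mat}_{(\delta+n-k)\times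 n}(R)$ and $\mathfrak{C}=\mathrm{Ker}(zK+L\mid M)=\{v(z)\in R[z]^n:\exists x(z)\in R[z]^\delta,\ (zK+L)x(z)+Mv(z)=0\}$. It is minimal if: (1) $K:R^\delta\to R^{\delta+n-k}$ is injective with $R$-flat cokernel; (2) $(K,M):R^{\delta+n}\to R^{\delta+n-k}$ is surjective; (3) $(zK+L,M):R[z]^{\delta+n}\to R[z]^{\delta+n-k}$ is surjective. Two representations $(K,L,M)$, $(K',L',M')$ are equivalent if there are invertible matrices $T\in GL_{\delta+n-k}(R)$, $S\in GL_\delta(R)$ with $(K',L',M')=(TKS^{-1},TLS^{-1},TM)$. A commutative ring $R$ is a ring with representations if every convolutional code over $R$ (of constant degree) has a minimal first order representation, unique up to equivalence. *)

(* Defs.v *)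
From HB Require Import structures.
From mathcomp Require Import all_boot all_algebra.
From mathcomp Require Import boolp.

Set Implicit Arguments.
Unset Strict Implicit.
Unset Printing Implicit Defensive.

Import GRing.Theory.
Local Open Scope ring_scope.
Local Open Scope quotient_scope.

(* Rings are [comNzRingType]s, i.e. nonzero: the constant value of the degree
   function on Spec R is only determined when Spec R is not empty. *)

Section QuotientModule.
Variables (R : comNzRingType) (V : lmodType R) (W : submodClosed V).

(* [submodClosed] does not inherit from [zmodClosed], which [Quotient.quot] needs. *)
Definition submod_pred : pred V := fun v => v \in W.

Lemma submod_pred_closed : zmod_closed submod_pred.
Proof.
have [W0 WB] := GRing.submod_closedB (submodClosedP W).
by split=> // u v; exact: WB.
Qed.
HB.instance Definition _ := GRing.isZmodClosed.Build V submod_pred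
  submod_pred_closed.

Definition submod_zmod : zmodClosed V := GRing.ZmodClosed.clone V submod_pred _.

Definition quotmod : Type := Quotient.quot submod_zmod.
HB.instance Definition _ := GRing.Zmodule.on quotmod.

Definition quotmod_pi (v : V) : quotmod := \pi_(Quotient.quot submod_zmod) v.

Lemma quotmod_piP u v : quotmod_pi u = quotmod_pi v <-> u - v \in W.
Proof.
have := Quotient.idealrBE submod_zmod u v.
rewrite unfold_in /= /submod_pred => ->.
by split=> [/eqP|/eqP].
Qed.

Lemma quotmod_pi_repr (x : quotmod) : quotmod_pi (repr x) = x.
Proof. exact: reprK. Qed.

Lemma quotmod_piD u v : quotmod_pi (u + v) = quotmod_pi u + quotmod_pi v.
Proof. by rewrite /quotmod_pi raddfD. Qed.

Definition quotmod_scale (a : R) (x : quotmod) : quotmod :=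
  quotmod_pi (a *: repr x).

Lemma quotmod_piZ a v : quotmod_pi (a *: v) = quotmod_scale a (quotmod_pi v).
Proof.
apply/quotmod_piP; rewrite -scalerBr rpredZ //.
by apply/quotmod_piP; rewrite quotmod_pi_repr.
Qed.

Lemma quotmod_scaleA a b x :
  quotmod_scale a (quotmod_scale b x) = quotmod_scale (a * b) x.
Proof. by rewrite -[x]quotmod_pi_repr -!quotmod_piZ scalerA. Qed.

Lemma quotmod_scale1 : left_id 1 quotmod_scale.
Proof. by move=> x; rewrite -[x]quotmod_pi_repr -quotmod_piZ scale1r. Qed.

Lemma quotmod_scaleDr : right_distributive quotmod_scale +%R.
Proof.
move=> a x y; rewrite -[x]quotmod_pi_repr -[y]quotmod_pi_repr.
by rewrite -quotmod_piD -!quotmod_piZ -quotmod_piD scalerDr.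
Qed.

Lemma quotmod_scaleDl x : {morph quotmod_scale^~ x : a b / a + b}.
Proof.
move=> a b; rewrite -[x]quotmod_pi_repr.
by rewrite -!quotmod_piZ -quotmod_piD scalerDl.
Qed.

HB.instance Definition _ := GRing.Zmodule_isLmodule.Build R quotmod
  quotmod_scaleA quotmod_scale1 quotmod_scaleDr quotmod_scaleDl.

End QuotientModule.

Definition restrict_scalars (R S : comNzRingType) (f : {rmorphism R -> S})
  (V : lmodType S) : Type := V.

Section RestrictScalars.
Variables (R S : comNzRingType) (f : {rmorphism R -> S}) (V : lmodType S).
Local Notation Vf := (restrict_scalars f V).

HB.instance Definition _ := GRing.Zmodule.copy Vf V.

Definition restrict_scale (a : R) (v : Vf) : Vf :=
  f a *: (v : V).

Lemma restrict_scaleA a b v :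
  restrict_scale a (restrict_scale b v) = restrict_scale (a * b) v.
Proof. by rewrite /restrict_scale scalerA rmorphM. Qed.

Lemma restrict_scale1 : left_id 1 restrict_scale.
Proof. by move=> v; rewrite /restrict_scale rmorph1 scale1r. Qed.

Lemma restrict_scaleDr : right_distributive restrict_scale +%R.
Proof. by move=> a u v; rewrite /restrict_scale scalerDr. Qed.

Lemma restrict_scaleDl v : {morph restrict_scale^~ v : a b / a + b}.
Proof. by move=> a b; rewrite /restrict_scale rmorphD scalerDl. Qed.

HB.instance Definition _ := GRing.Zmodule_isLmodule.Build R Vf
  restrict_scaleA restrict_scale1 restrict_scaleDr restrict_scaleDl.

End RestrictScalars.

(* The sequence [:: (m1, n1); ...; (mr, nr)] stands for the tensor
   m1 (x) n1 + ... + mr (x) nr, and [tensor_eq s t] is equality of s and t in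
   M (x)_R N, presented by generators and bilinear relations. Opposites are not
   needed in the presentation, since - (m (x) n) = (- m) (x) n. *)
Inductive tensor_eq (R : comNzRingType) (M N : lmodType R) :
    seq (M * N) -> seq (M * N) -> Prop :=
| tensor_refl s : tensor_eq s s
| tensor_sym s t : tensor_eq s t -> tensor_eq t s
| tensor_trans s t u : tensor_eq s t -> tensor_eq t u -> tensor_eq s u
| tensor_cat s s' t t' :
    tensor_eq s s' -> tensor_eq t t' -> tensor_eq (s ++ t) (s' ++ t')
| tensor_catC s t : tensor_eq (s ++ t) (t ++ s)
| tensor_0 n : tensor_eq [:: (0, n)] [::]
| tensor_Dl m m' n : tensor_eq [:: (m + m', n)] [:: (m, n); (m', n)]
| tensor_Dr m n n' : tensor_eq [:: (m, n + n')] [:: (m, n); (m, n')]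
| tensor_Z a m n : tensor_eq [:: (a *: m, n)] [:: (m, a *: n)].

(* M is flat: id (x) f : M (x) N' -> M (x) N is injective whenever f is. *)
Definition flat (R : comNzRingType) (M : lmodType R) : Prop :=
  forall (N' N : lmodType R) (f : {linear N' -> N}), injective f ->
  forall s t : seq (M * N'),
    tensor_eq [seq (x.1, f x.2) | x <- s] [seq (x.1, f x.2) | x <- t] ->
    tensor_eq s t.

(* Spec R is the type [prime_idealr R] of (boolean) prime ideals; inverses in
   R / p are chosen classically, as [{fraction _}] asks for an [idomainType]. *)
Section ResidueField.
Variables (R : comNzRingType) (p : prime_idealr R).

Definition residue_domain : Type := {ideal_quot p}.
HB.instance Definition _ := GRing.ComNzRing.on residue_domain.

Definition residue_unit : pred residue_domain :=
  fun x => `[< exists y, y * x = 1 >].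

Definition residue_inv (x : residue_domain) : residue_domain :=
  if pselect (exists y, y * x = 1) is left xV then projT1 (cid xV) else x.

Lemma residue_mulVx : {in residue_unit, left_inverse 1 residue_inv *%R}.
Proof.
move=> x /asboolP xV; rewrite /residue_inv.
by case: pselect => // xV'; case: cid.
Qed.

Lemma residue_unitP x y : y * x = 1 -> residue_unit x.
Proof. by move=> yx; apply/asboolP; exists y. Qed.

Lemma residue_inv_out : {in [predC residue_unit], residue_inv =1 id}.
Proof.
move=> x /negP xNV; rewrite /residue_inv.
by case: pselect => // xV; case: xNV; apply/asboolP.
Qed.

HB.instance Definition _ := GRing.ComNzRing_hasMulInverse.Build residue_domain
  residue_mulVx residue_unitP residue_inv_out.

Lemma residue_mulf_eq0 (x y : residue_domain) :
  x * y = 0 -> (x == 0) || (y == 0).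
Proof. exact: Quotient.rquot_IdomainAxiom. Qed.

HB.instance Definition _ := GRing.ComUnitRing_isIntegral.Build residue_domain
  residue_mulf_eq0.

Definition residue_field : fieldType := {fraction residue_domain}.

Definition residue_proj (a : R) : residue_domain := \pi_{ideal_quot p} a.

Lemma residue_proj_zmod : zmod_morphism residue_proj.
Proof. by move=> a b; rewrite /residue_proj raddfB. Qed.
HB.instance Definition _ := GRing.isZmodMorphism.Build R residue_domain
  residue_proj residue_proj_zmod.

Lemma residue_proj_monoid : monoid_morphism residue_proj.
Proof. by split=> [|a b]; rewrite /residue_proj ?rmorph1 ?rmorphM. Qed.
HB.instance Definition _ := GRing.isMonoidMorphism.Build R residue_domain
  residue_proj residue_proj_monoid.

Definition to_residue : {rmorphism R -> residue_field} :=
  (@FracField.tofrac residue_domain) \o residue_proj.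

End ResidueField.

Section Codes.
Variables (R : comNzRingType) (n k : nat).
Implicit Types C : submodClosed 'cV[{poly R}]_n.

Definition free_of_rank C : Prop :=
  exists G : 'M[{poly R}]_(n, k),
    injective (fun u : 'cV_k => G *m u) /\
    (forall v, v \in C <-> exists u : 'cV_k, v = G *m u).

Definition is_code C : Prop :=
  [/\ (k <= n)%N, free_of_rank C &
      flat (restrict_scalars polyC (quotmod C))].

(* C(p) as a subset of k(p)[z]^n : the image of C (x)_R k(p) under
   c (x) a |-> a . (c mod p); this map is injective as R[z]^n / C is R-flat. *)
Definition code_fiber C (p : prime_idealr R)
    (v : 'cV[{poly residue_field p}]_n) : Prop :=
  exists (r : nat) (a : 'I_r -> residue_field p) (c : 'I_r -> 'cV[{poly R}]_n),
    (forall i, c i \in C) /\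
    v = \sum_(i < r) (a i)%:P *: map_mx (map_poly (to_residue p)) (c i).

End Codes.

(* Degrees are [size - 1]; minors that vanish count as degree 0, which is
   harmless as some maximal minor of a matrix of rank k is nonzero. *)
Definition max_minor_degree (F : fieldType) (n k : nat)
    (G : 'M[{poly F}]_(n, k)) : nat :=
  \max_(f : {ffun 'I_k -> 'I_n} |
         [forall i : 'I_k, forall j : 'I_k, (i < j)%N ==> (f i < f j)%N])
    (size (\det (rowsub f G))).-1.

Definition generated_by (F : fieldType) (n k : nat)
    (D : 'cV[{poly F}]_n -> Prop) (G : 'M[{poly F}]_(n, k)) : Prop :=
  forall v, D v <-> exists u : 'cV_k, v = G *m u.

(* For a code the condition is not vacuous: reducing a basis of C modulo p gives
   at least one such G. *)
Definition code_degree_at (R : comNzRingType) (n k : nat)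
    (C : submodClosed 'cV[{poly R}]_n) (p : prime_idealr R) (d : nat) : Prop :=
  forall G : 'M[{poly residue_field p}]_(n, k),
    generated_by (code_fiber C (p := p)) G -> max_minor_degree G = d.

Definition code_degree (R : comNzRingType) (n k : nat)
    (C : submodClosed 'cV[{poly R}]_n) (d : nat) : Prop :=
  forall p : prime_idealr R, code_degree_at k C p d.

(* Ker(A | B) for matrices, acting on column vectors. *)
Definition ker_pair (A : comNzRingType) (m r s : nat)
    (f1 : 'M[A]_(m, r)) (f2 : 'M[A]_(m, s)) (v : 'cV[A]_s) : Prop :=
  exists x : 'cV_r, f1 *m x + f2 *m v = 0.

Section Cokernel.
Variables (R : comNzRingType) (m r : nat) (K : 'M[R]_(m, r)).

Definition im_mx : pred 'cV[R]_m :=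
  fun v => `[< exists u : 'cV_r, v = K *m u >].

Lemma im_mx_closed : GRing.subsemimod_closed im_mx.
Proof.
split; first split.
- by apply/asboolP; exists 0; rewrite mulmx0.
- move=> _ _ /asboolP[u ->] /asboolP[v ->].
  by apply/asboolP; exists (u + v); rewrite mulmxDr.
- move=> a _ /asboolP[u ->].
  by apply/asboolP; exists (a *: u); rewrite -scalemxAr.
Qed.
HB.instance Definition _ := GRing.isSubmodClosed.Build R 'cV[R]_m im_mx
  im_mx_closed.

Definition coker_mx : lmodType R := quotmod (GRing.SubmodClosed.clone R 'cV[R]_m im_mx _).

End Cokernel.

Section Representations.
Variables (R : comNzRingType) (n k d : nat).

(* A triple is written (K, L, M). *)
Definition for_triple : Type :=
  'M[R]_(d + n - k, d) * 'M[R]_(d + n - k, d) * 'M[R]_(d + n - k, n).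

Definition pencil (K L : 'M[R]_(d + n - k, d)) : 'M[{poly R}]_(d + n - k, d) :=
  'X *: map_mx polyC K + map_mx polyC L.

Definition represents (C : submodClosed 'cV[{poly R}]_n) (X : for_triple) :
    Prop :=
  let: (K, L, M) := X in
  forall v, v \in C <-> ker_pair (pencil K L) (map_mx polyC M) v.

Definition minimal (X : for_triple) : Prop :=
  let: (K, L, M) := X in
  [/\ injective (fun x : 'cV_d => K *m x) /\ flat (coker_mx K),
      (forall y : 'cV_(d + n - k), exists x : 'cV_(d + n), row_mx K M *m x = y) &
      (forall y : 'cV[{poly R}]_(d + n - k), exists x : 'cV_(d + n),
         row_mx (pencil K L) (map_mx polyC M) *m x = y)].

Definition inverse_mx (m : nat) (A B : 'M[R]_m) : Prop :=
  A *m B = 1%:M /\ B *m A = 1%:M.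

(* [S'] is the inverse of S. *)
Definition equivalent (X X' : for_triple) : Prop :=
  let: (K, L, M) := X in let: (K', L', M') := X' in
  exists (T T' : 'M[R]_(d + n - k)) (S S' : 'M[R]_d),
    [/\ inverse_mx T T', inverse_mx S S' &
        (K', L', M') = (T *m K *m S', T *m L *m S', T *m M)].

End Representations.

Definition ring_with_representations (R : comNzRingType) : Prop :=
  forall (n k d : nat) (C : submodClosed 'cV[{poly R}]_n),
    is_code k C -> code_degree k C d ->
    (exists X : for_triple R n k d, represents C X /\ minimal X) /\
    (forall X X' : for_triple R n k d,
       represents C X -> minimal X -> represents C X' -> minimal X' ->
       equivalent X X').

(* The direct product of t + 1 rings, with componentwise operations; there is
   at least one factor, so the product is a nonzero ring. *)
Section ProductRing.
Variables (t : nat) (R : 'I_t.+1 -> comNzRingType).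

Definition prod_ring : Type := {dffun forall i : 'I_t.+1, R i}.
HB.instance Definition _ := Choice.on prod_ring.
Implicit Types x y z : prod_ring.

Definition prod_mk (f : forall i, R i) : prod_ring := finfun f.

Lemma prod_mkE f i : prod_mk f i = f i.
Proof. exact: ffunE. Qed.

Definition prod_zero := prod_mk (fun i => 0).
Definition prod_opp x := prod_mk (fun i => - x i).
Definition prod_add x y := prod_mk (fun i => x i + y i).
Definition prod_one := prod_mk (fun i => 1).
Definition prod_mul x y := prod_mk (fun i => x i * y i).

Lemma prod_addA : associative prod_add.
Proof. by move=> x y z; apply/ffunP=> i; rewrite !prod_mkE addrA. Qed.
Lemma prod_addC : commutative prod_add.
Proof. by move=> x y; apply/ffunP=> i; rewrite !prod_mkE addrC. Qed.
Lemma prod_add0 : left_id prod_zero prod_add.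
Proof. by move=> x; apply/ffunP=> i; rewrite !prod_mkE add0r. Qed.
Lemma prod_addN : left_inverse prod_zero prod_opp prod_add.
Proof. by move=> x; apply/ffunP=> i; rewrite !prod_mkE addNr. Qed.

HB.instance Definition _ := GRing.isZmodule.Build prod_ring
  prod_addA prod_addC prod_add0 prod_addN.

Lemma prod_mulA : associative prod_mul.
Proof. by move=> x y z; apply/ffunP=> i; rewrite !prod_mkE mulrA. Qed.
Lemma prod_mulC : commutative prod_mul.
Proof. by move=> x y; apply/ffunP=> i; rewrite !prod_mkE mulrC. Qed.
Lemma prod_mul1 : left_id prod_one prod_mul.
Proof. by move=> x; apply/ffunP=> i; rewrite !prod_mkE mul1r. Qed.
Lemma prod_mulD : left_distributive prod_mul +%R.
Proof. by move=> x y z; apply/ffunP=> i; rewrite !prod_mkE mulrDl. Qed.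
Lemma prod_one_neq0 : prod_one != 0.
Proof. by apply/eqP=> /ffunP/(_ ord0)/eqP; rewrite !prod_mkE oner_eq0. Qed.

HB.instance Definition _ := GRing.Zmodule_isComNzRing.Build prod_ring
  prod_mulA prod_mulC prod_mul1 prod_mulD prod_one_neq0.

End ProductRing.

(* Main.v *)
From HB Require Import structures.
Require Import Defs.
From mathcomp Require Import all_boot all_algebra.
From mathcomp Require Import boolp.

(** The product ring R comes with projections g_j : R -> R_j and additive
sections h_j : R_j -> R that put a on the j-th place and 0 elsewhere; the
idempotents e_j = h_j 1 sum to 1. Everything that occurs in the definition of a
ring with representations splits along the e_j, so a code C over R amounts to
codes C_j over the R_j, and a representation of C to representations of the C_j.

Two facts are used about each factor separately (a pair (g, h) as above with
h (g a * b) = a * h b). The part C_j of a code C, consisting of the w with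
h_j w in C, is again a code of the same rank ([is_code_part]) and the same
degree ([code_degree_part]). The image of a minimal representation of C under
g_j is a minimal representation of C_j ([represents_part], [minimal_part]).
In the other direction matrices over the R_j, and over the R_j[z], are glued
entry by entry, and all equations can be checked after applying every g_j.
Hence minimal representations of the C_j glue to one of C ([represents_glue],
[minimal_glue]), which is existence, and the equivalences between the parts of
two representations of C glue to an equivalence ([equivalent_glue]), which is
uniqueness.

Two points are not formal. Flatness: with R-modules M and R_j-modules M_j
related by maps M -> M_j -> M, tensors are moved between M (x) N and
M_j (x) N_j along pairs of maps that respect scalars only up to g_j or h_j
([tensor_eq_map]). A flat M makes its retract M_j flat ([flat_semiretract]);
conversely an equality of tensors can be checked after multiplication by each
e_j, that is in the M_j, so flat M_j make M flat ([flat_product]). Degree: a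
prime p of R_j and its preimage in R have the same residue field
([residue_field_iso]), and the fibers of C_j and C correspond. *)

Set Implicit Arguments.
Unset Strict Implicit.
Unset Printing Implicit Defensive.

Import GRing.Theory.
Local Open Scope ring_scope.
Local Open Scope quotient_scope.

(** * Tensors and maps that change the ring of scalars *)

(** [rho] is a mere function because it is used both for a projection
R -> R_j and for the section R_j -> R, which does not preserve 1. *)
Definition semilinear_along (R S : comNzRingType) (rho : R -> S)
    (M : lmodType R) (N : lmodType S) (phi : M -> N) : Prop :=
  {morph phi : x y / x + y} /\ forall a m, phi (a *: m) = rho a *: phi m.

Lemma semilinear0 (R S : comNzRingType) (rho : R -> S)
    (M : lmodType R) (N : lmodType S) (phi : M -> N) :
  semilinear_along rho phi -> phi 0 = 0.
Proof. by case=> phiD _; apply: (addrI (phi 0)); rewrite -phiD !addr0. Qed.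

(** Each generating relation of the tensor product over R is sent to one over S.
The relation for scalars survives because [phi] and [psi] twist scalars by the
same [rho]. *)
Lemma tensor_eq_map (R S : comNzRingType) (rho : R -> S)
    (M N : lmodType R) (M' N' : lmodType S) (phi : M -> M') (psi : N -> N')
    (s t : seq (M * N)) :
  semilinear_along rho phi -> semilinear_along rho psi -> tensor_eq s t ->
  tensor_eq [seq (phi x.1, psi x.2) | x <- s] [seq (phi x.1, psi x.2) | x <- t].
Proof.
move=> phiL psiL; have [phiD phiZ] := phiL; have [psiD psiZ] := psiL.
elim=> {s t} [s|s t _|s t u _ st _|s s' t t' _ IHs _ IHt|s t|n|m m' n|m n n'
             |a m n] /=.
- exact: tensor_refl.
- exact: tensor_sym.
- exact: tensor_trans.
- by rewrite !map_cat; apply: tensor_cat.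
- by rewrite !map_cat; apply: tensor_catC.
- by rewrite (semilinear0 phiL); apply: tensor_0.
- by rewrite phiD; apply: tensor_Dl.
- by rewrite psiD; apply: tensor_Dr.
- by rewrite phiZ psiZ; apply: tensor_Z.
Qed.

Section TensorScale.
Variables (R : comNzRingType) (M N : lmodType R).
Implicit Types s t : seq (M * N).

Definition tensor_scale (a : R) s := [seq (a *: x.1, x.2) | x <- s].

Lemma tensor_catAC s t u v :
  tensor_eq ((s ++ t) ++ (u ++ v)) ((s ++ u) ++ (t ++ v)).
Proof.
rewrite -!catA; apply: tensor_cat; first exact: tensor_refl.
rewrite !catA; apply: tensor_cat; [exact: tensor_catC|exact: tensor_refl].
Qed.

Lemma tensor_scale0 s : tensor_eq (tensor_scale 0 s) [::].
Proof.
elim: s => [|x s IHs] /=; first exact: tensor_refl.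
rewrite scale0r -[in X in tensor_eq X]cat1s -[[::]]cats0.
by apply: tensor_cat IHs; apply: tensor_0.
Qed.

Lemma tensor_scaleD a b s :
  tensor_eq (tensor_scale (a + b) s) (tensor_scale a s ++ tensor_scale b s).
Proof.
elim: s => [|x s IHs] /=; first exact: tensor_refl.
rewrite scalerDl -cat1s -[_ :: _ ++ _]/(([:: (a *: x.1, x.2)] ++ _) ++ _).
rewrite -[_ :: tensor_scale b s]cat1s.
apply: tensor_trans (tensor_catAC _ _ _ _).
by apply: tensor_cat IHs; apply: tensor_Dl.
Qed.

(** The scalars a with a s = a t in M (x) N are closed under sums, so 1 is one
of them as soon as the e_i are. *)
Lemma tensor_eq_partition (I : finType) (e : I -> R) s t :
  \sum_i e i = 1 ->
  (forall i, tensor_eq (tensor_scale (e i) s) (tensor_scale (e i) t)) ->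
  tensor_eq s t.
Proof.
move=> e1 est.
have scale1 u : tensor_scale 1 u = u.
  by elim: u => //= -[m n] u ->; rewrite scale1r.
rewrite -[s]scale1 -[t]scale1 -e1.
apply: (big_ind (fun a => tensor_eq (tensor_scale a s) (tensor_scale a t))).
- exact: tensor_trans (tensor_scale0 s) (tensor_sym (tensor_scale0 t)).
- move=> a b IHa IHb; apply: tensor_trans (tensor_scaleD a b s) _.
  apply: tensor_trans (tensor_cat IHa IHb) _.
  exact: tensor_sym (tensor_scaleD a b t).
- by move=> i _; apply: est.
Qed.

(** e m (x) e n = e e m (x) n: an idempotent acting on both sides of a tensor
acts as it does on one side. *)
Lemma tensor_scale_idem (e : R) s : e * e = e ->
  tensor_eq [seq (e *: x.1, e *: x.2) | x <- s] (tensor_scale e s).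
Proof.
move=> ee; elim: s => [|[m n] s IHs] /=; first exact: tensor_refl.
rewrite -cat1s -[_ :: tensor_scale _ _]cat1s; apply: tensor_cat IHs.
rewrite -[in X in tensor_eq _ X]ee -scalerA.
by apply: tensor_sym; apply: tensor_Z.
Qed.

End TensorScale.

(** * Direct factors of a ring *)

(** S is a direct factor of R: [factorMl] makes [h] linear over R, so it embeds
S as the ideal generated by the idempotent [h 1]. *)
Record factor (R S : comNzRingType) (g : {rmorphism R -> S})
    (h : {additive S -> R}) : Prop := Factor {
  factorK : cancel h g;
  factorMl : forall a b, h (g a * b) = a * h b }.

Section FactorTheory.
Variables (R S : comNzRingType).
Variables (g : {rmorphism R -> S}) (h : {additive S -> R}).
Hypothesis gh : factor g h.

Lemma factorM : {morph h : a b / a * b}.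
Proof. by move=> a b; rewrite -{1}(factorK gh a) (factorMl gh). Qed.

Lemma factor_retract a : h (g a) = a * h 1.
Proof. by rewrite -[g a]mulr1 (factorMl gh). Qed.

Lemma factor_idem : h 1 * h 1 = h 1.
Proof. by rewrite -factorM mulr1. Qed.

End FactorTheory.

Section FactorPartPred.
Variables (R S : comNzRingType) (h : {additive S -> R}) (N : lmodType R).

Definition factor_part_pred : pred N := fun n => h 1 *: n == n.

Lemma factor_part_closed : zmod_closed factor_part_pred.
Proof.
split=> [|m n /eqP em /eqP en]; apply/eqP; first exact: scaler0.
by rewrite scalerBr em en.
Qed.
HB.instance Definition _ :=
  GRing.isZmodClosed.Build N factor_part_pred factor_part_closed.

End FactorPartPred.

(** The submodule e N of an R-module N, for e = h 1. It carries the structure of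
an S-module, which is why the proof [gh] is an index of the type. *)
Definition factor_part (R S : comNzRingType) (g : {rmorphism R -> S})
    (h : {additive S -> R}) (gh : factor g h) (N : lmodType R) : Type :=
  {n : N | factor_part_pred h n}.

Section FactorPart.
Variables (R S : comNzRingType).
Variables (g : {rmorphism R -> S}) (h : {additive S -> R}).
Variables (gh : factor g h) (N : lmodType R).
Local Notation Ne := (factor_part gh N).

HB.instance Definition _ := SubType.on Ne.
HB.instance Definition _ := Choice.on Ne.
HB.instance Definition _ := [SubChoice_isSubZmodule of Ne by <:].

Lemma factor_part_scaleP (a : S) (n : N) : factor_part_pred h (h a *: n).
Proof. by rewrite /factor_part_pred scalerA -(factorM gh) mul1r. Qed.

Definition factor_part_scale (a : S) (n : Ne) : Ne :=
  Sub (h a *: val n) (factor_part_scaleP a (val n)).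

Lemma factor_part_scaleA a b n :
  factor_part_scale a (factor_part_scale b n) = factor_part_scale (a * b) n.
Proof. by apply: val_inj; rewrite !SubK scalerA (factorM gh). Qed.

Lemma factor_part_scale1 : left_id 1 factor_part_scale.
Proof. by move=> n; apply: val_inj; rewrite SubK; apply/eqP/(valP n). Qed.

Lemma factor_part_scaleDr : right_distributive factor_part_scale +%R.
Proof. by move=> a m n; apply: val_inj; rewrite raddfD !SubK scalerDr. Qed.

Lemma factor_part_scaleDl n : {morph factor_part_scale^~ n : a b / a + b}.
Proof.
by move=> a b; apply: val_inj; rewrite raddfD !SubK raddfD scalerDl.
Qed.

HB.instance Definition _ := GRing.Zmodule_isLmodule.Build S Ne
  factor_part_scaleA factor_part_scale1 factor_part_scaleDr
  factor_part_scaleDl.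

Definition factor_part_proj (n : N) : Ne :=
  Sub (h 1 *: n) (factor_part_scaleP 1 n).

Lemma factor_part_proj_semilinear : semilinear_along g factor_part_proj.
Proof.
split=> [m n|a n]; apply: val_inj; first by rewrite raddfD !SubK scalerDr.
by rewrite !SubK !scalerA (factor_retract gh) -mulrA (factor_idem gh) mulrC.
Qed.

Lemma factor_part_val_semilinear : semilinear_along h (val : Ne -> N).
Proof. by []. Qed.

End FactorPart.

Section FactorPartMap.
Variables (R S : comNzRingType).
Variables (g : {rmorphism R -> S}) (h : {additive S -> R}).
Variables (gh : factor g h) (N' N : lmodType R) (f : {linear N' -> N}).

Lemma factor_part_mapP (n : factor_part gh N') :
  factor_part_pred h (f (val n)).
Proof. by rewrite /factor_part_pred -linearZ (eqP (valP n)). Qed.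

Definition factor_part_map (n : factor_part gh N') : factor_part gh N :=
  Sub (f (val n)) (factor_part_mapP n).

Lemma factor_part_map_linear : linear factor_part_map.
Proof.
move=> a m n; apply: val_inj.
by rewrite raddfD /= !raddfD /= linearZ.
Qed.
HB.instance Definition _ := GRing.isLinear.Build S (factor_part gh N')
  (factor_part gh N) _ factor_part_map factor_part_map_linear.

Lemma factor_part_map_inj : injective f -> injective factor_part_map.
Proof. by move=> f_inj m n [/f_inj/val_inj]. Qed.

End FactorPartMap.

(** * Flatness over a factor and over a product *)

Section RestrictMap.
Variables (R S : comNzRingType) (g : {rmorphism R -> S}).
Variables (N' N : lmodType S) (f : {linear N' -> N}).

Definition restrict_map :
  restrict_scalars g N' -> restrict_scalars g N := f.

Lemma restrict_map_linear : linear restrict_map.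
Proof. by move=> a m n; rewrite /restrict_map linearP. Qed.
HB.instance Definition _ := GRing.isLinear.Build R (restrict_scalars g N')
  (restrict_scalars g N) _ restrict_map restrict_map_linear.

End RestrictMap.

(** An S-module N is an R-module through g, and the identity of N is compatible
with [g] in one direction and with [h] in the other. So an equality in
M' (x) N goes up to M (x) N along [chi], is cancelled to M (x) N' by flatness
of M, and comes back along [phi]. *)
Lemma flat_semiretract (R S : comNzRingType) (g : {rmorphism R -> S})
    (h : S -> R) (M : lmodType R) (M' : lmodType S)
    (phi : M -> M') (chi : M' -> M) :
  cancel h g -> semilinear_along g phi -> semilinear_along h chi ->
  cancel chi phi ->
  flat M -> flat M'.
Proof.
move=> hK phiL chiL chiK flatM N' N f f_inj s t st.
pose up (V : lmodType S) : V -> restrict_scalars g V := id.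
pose down (V : lmodType S) : restrict_scalars g V -> V := id.
have upL V : semilinear_along h (up V).
  by split=> // a m; rewrite /up -{1}[a]hK.
have downL V : semilinear_along g (down V) by [].
have backE (u : seq (M' * N')) : [seq (phi x.1, down N' x.2) |
      x <- [seq (chi x.1, up N' x.2) | x <- u]] = u.
  by rewrite -map_comp map_id_in // => -[m n] _ /=; rewrite chiK.
rewrite -[s]backE -[t]backE; apply: (tensor_eq_map phiL (downL N')).
pose fg : {linear restrict_scalars g N' -> restrict_scalars g N} :=
  @restrict_map _ _ g _ _ f.
apply: (flatM _ _ fg f_inj).
by have := tensor_eq_map chiL (upL N) st; rewrite -!map_comp.
Qed.

(** Let e = h i 1. An equality in M (x) N goes to M'_i (x) e N along [phi i] and
n |-> e n, is cancelled to M'_i (x) e N' by flatness of M'_i, and comes back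
along [chi i] as the original equality multiplied by e. This being so for all
i, the factor e disappears. *)
Lemma flat_product (I : finType) (R : comNzRingType) (S : I -> comNzRingType)
    (g : forall i, {rmorphism R -> S i}) (h : forall i, {additive S i -> R})
    (M : lmodType R) (M' : forall i, lmodType (S i))
    (phi : forall i, M -> M' i) (chi : forall i, M' i -> M) :
  (forall i, factor (g i) (h i)) -> \sum_i h i 1 = 1 ->
  (forall i, semilinear_along (g i) (phi i)) ->
  (forall i, semilinear_along (h i) (chi i)) ->
  (forall i m, chi i (phi i m) = h i 1 *: m) ->
  (forall i, flat (M' i)) -> flat M.
Proof.
move=> gh h1 phiL chiL chiphi flatM' N' N f f_inj s t st.
apply: (tensor_eq_partition h1) => i.
pose e := h i 1; have ee : e * e = e := factor_idem (gh i).
suff est : tensor_eq [seq (e *: x.1, e *: x.2) | x <- s]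
                     [seq (e *: x.1, e *: x.2) | x <- t].
  apply: tensor_trans (tensor_sym (tensor_scale_idem s ee)) _.
  exact: tensor_trans est (tensor_scale_idem t ee).
have backE (u : seq (M * N')) :
    [seq (e *: x.1, e *: x.2) | x <- u] =
    [seq (chi i x.1, val x.2) |
      x <- [seq (phi i x.1, factor_part_proj (gh i) x.2) | x <- u]].
  rewrite -map_comp; apply: eq_map => x /=.
  by rewrite chiphi.
rewrite !backE.
apply: (tensor_eq_map (chiL i) (factor_part_val_semilinear _ _)).
pose fi : {linear factor_part (gh i) N' -> factor_part (gh i) N} :=
  @factor_part_map _ _ _ _ (gh i) _ _ f.
apply: (flatM' i _ _ fi); first exact: factor_part_map_inj.
have := tensor_eq_map (phiL i) (factor_part_proj_semilinear (gh i) N) st.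
rewrite -!map_comp.
have fE (x : M * N') : (phi i x.1, factor_part_proj (gh i) (f x.2)) =
  (phi i x.1, fi (factor_part_proj (gh i) x.2)).
  by congr pair; apply: val_inj; rewrite !SubK linearZ.
by rewrite !(eq_map fE).
Qed.

(** * Quotients and matrices over a factor *)

Section QuotientMap.
Variables (R S : comNzRingType) (rho : R -> S).
Variables (V : lmodType R) (V' : lmodType S).
Variables (W : submodClosed V) (W' : submodClosed V').
Variable phi : V -> V'.

Definition quotmod_map (x : quotmod W) : quotmod W' :=
  quotmod_pi W' (phi (repr x)).

Hypothesis phiL : semilinear_along rho phi.
Hypothesis phiW : {homo phi : v / v \in W >-> v \in W'}.

Lemma quotmod_mapE v : quotmod_map (quotmod_pi W v) = quotmod_pi W' (phi v).
Proof.
have [phiD _] := phiL.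
set x := quotmod_pi W v; have xv : repr x - v \in W.
  by apply/quotmod_piP; rewrite quotmod_pi_repr.
apply/quotmod_piP; have <- : phi (repr x - v) = phi (repr x) - phi v.
  by apply: (addIr (phi v)); rewrite -phiD !subrK.
exact: phiW.
Qed.

Lemma quotmod_map_semilinear : semilinear_along rho quotmod_map.
Proof.
have [phiD phiZ] := phiL.
split=> [x y|a x]; rewrite -[x]quotmod_pi_repr.
  rewrite -[y]quotmod_pi_repr -quotmod_piD !quotmod_mapE.
  by rewrite phiD quotmod_piD.
rewrite -[a *: _]quotmod_piZ !quotmod_mapE phiZ.
exact: quotmod_piZ.
Qed.

End QuotientMap.

(** S[z] is a factor of R[z] with coefficientwise maps, so all results about
factors also apply to polynomial matrices. *)
Lemma factor_poly (R S : comNzRingType) (g : {rmorphism R -> S})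
    (h : {additive S -> R}) :
  factor g h -> factor (map_poly g) (map_poly h).
Proof.
move=> gh; split=> [p|p q]; first exact: (map_polyK (factorK gh) (raddf0 g)).
apply/polyP => i; rewrite coef_map !coefM raddf_sum; apply: eq_bigr => j _.
by rewrite !coef_map factorMl.
Qed.

Section FactorMx.
Variables (R S : comNzRingType).
Variables (g : {rmorphism R -> S}) (h : {additive S -> R}).
Hypothesis gh : factor g h.

Lemma factor_mxK m n : cancel (@map_mx _ _ h m n) (map_mx g).
Proof. by move=> A; apply/matrixP => i j; rewrite !mxE (factorK gh). Qed.

(** This is how equations over S are lifted to R: a system with matrix g A
solved by B over S has matrix A and solution h B over R. *)
Lemma factor_mulmx m n p (A : 'M_(m, n)) (B : 'M_(n, p)) :
  map_mx h (map_mx g A *m B) = A *m map_mx h B.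
Proof.
apply/matrixP => i j; rewrite !mxE raddf_sum; apply: eq_bigr => k _.
by rewrite !mxE factorMl.
Qed.

Lemma factor_mx_retract m n (A : 'M_(m, n)) :
  map_mx h (map_mx g A) = h 1 *: A.
Proof.
by apply/matrixP => i j; rewrite !mxE (factor_retract gh) mulrC.
Qed.

Lemma map_mx_semilinear m n : semilinear_along g (@map_mx _ _ g m n).
Proof. by split=> [A B|a A]; rewrite ?map_mxD ?map_mxZ. Qed.

Lemma factor_mx_semilinear m n : semilinear_along h (@map_mx _ _ h m n).
Proof.
split=> [A B|a A]; first by rewrite map_mxD.
by apply/matrixP => i j; rewrite !mxE (factorM gh).
Qed.

Lemma flat_coker_factor m r (K : 'M[R]_(m, r)) :
  flat (coker_mx K) -> flat (coker_mx (map_mx g K)).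
Proof.
set W := im_mx K; set W' := im_mx (map_mx g K).
have gW : {homo map_mx g : v / v \in W >-> v \in W'}.
  by move=> _ /asboolP[u ->]; apply/asboolP; exists (map_mx g u);
    rewrite map_mxM.
have hW : {homo map_mx h : v / v \in W' >-> v \in W}.
  move=> _ /asboolP[u ->]; apply/asboolP; exists (map_mx h u).
  exact: factor_mulmx.
have gL := quotmod_map_semilinear (map_mx_semilinear m 1) gW.
have hL := quotmod_map_semilinear (factor_mx_semilinear m 1) hW.
apply: (flat_semiretract (factorK gh) gL hL) => x.
rewrite -[x]quotmod_pi_repr (quotmod_mapE (factor_mx_semilinear m 1) hW).
by rewrite (quotmod_mapE (map_mx_semilinear m 1) gW) factor_mxK.
Qed.

End FactorMx.

Lemma flat_coker_product (I : finType) (R : comNzRingType)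
    (S : I -> comNzRingType) (g : forall i, {rmorphism R -> S i})
    (h : forall i, {additive S i -> R}) m r (K : 'M[R]_(m, r)) :
  (forall i, factor (g i) (h i)) -> \sum_i h i 1 = 1 ->
  (forall i, flat (coker_mx (map_mx (g i) K))) -> flat (coker_mx K).
Proof.
move=> gh h1.
set W := im_mx K; pose W' i := im_mx (map_mx (g i) K).
have gW i : {homo map_mx (g i) : v / v \in W >-> v \in W' i}.
  move=> _ /asboolP[u ->]; apply/asboolP; exists (map_mx (g i) u).
  by rewrite map_mxM.
have hW i : {homo map_mx (h i) : v / v \in W' i >-> v \in W}.
  move=> _ /asboolP[u ->]; apply/asboolP; exists (map_mx (h i) u).
  exact: factor_mulmx.
have gL i := map_mx_semilinear (g i) m 1.
have hL i := factor_mx_semilinear (gh i) m 1.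
apply: (flat_product gh h1 (fun i => quotmod_map_semilinear (gL i) (gW i))
   (fun i => quotmod_map_semilinear (hL i) (hW i))) => i x.
rewrite -[x]quotmod_pi_repr (quotmod_mapE (gL i) (gW i)).
rewrite (quotmod_mapE (hL i) (hW i)) (factor_mx_retract (gh i)).
exact: quotmod_piZ.
Qed.

(** * The part of a code over a factor *)

Lemma semilinear_restrict (R S A B : comNzRingType) (rho : R -> S)
    (sigma : A -> B) (f : {rmorphism R -> A}) (f' : {rmorphism S -> B})
    (M : lmodType A) (N : lmodType B) (phi : M -> N) :
  (forall a, sigma (f a) = f' (rho a)) -> semilinear_along sigma phi ->
  semilinear_along rho
    (phi : restrict_scalars f M -> restrict_scalars f' N).
Proof.
move=> sf [phiD phiZ]; split=> // a m.
exact: etrans (phiZ (f a) m) (congr1 ( *:%R^~ (phi m)) (sf a)).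
Qed.

Section CodePart.
Variables (R S : comNzRingType).
Variables (g : {rmorphism R -> S}) (h : {additive S -> R}).
Variables (gh : factor g h) (n : nat).
Local Notation gP := (map_poly g).
Local Notation hP := (map_poly h).
Let ghP := factor_poly gh.

(** The image of C under [g], described by [h] because membership is then that
of C; see [code_part_proj] for the comparison. *)
Definition code_part_pred (gh : factor g h) (C : submodClosed 'cV[{poly R}]_n) :
  pred 'cV[{poly S}]_n := fun w => map_mx hP w \in C.

Variable C : submodClosed 'cV[{poly R}]_n.

Lemma code_part_closed : GRing.subsemimod_closed (code_part_pred gh C).
Proof.
have [hD hZ] := factor_mx_semilinear ghP n 1.
split; first split.
- by rewrite -topredE /= /code_part_pred map_mx0 rpred0.
- move=> u v Cu Cv; rewrite -topredE /= /code_part_pred hD.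
  exact: (rpredD (Cu : _ \in C) Cv).
- move=> a v Cv; rewrite -topredE /= /code_part_pred hZ.
  exact: (rpredZ _ (Cv : _ \in C)).
Qed.
HB.instance Definition _ := GRing.isSubmodClosed.Build {poly S}
  'cV[{poly S}]_n (code_part_pred gh C) code_part_closed.

Definition code_part : submodClosed 'cV[{poly S}]_n :=
  GRing.SubmodClosed.clone {poly S} 'cV[{poly S}]_n (code_part_pred gh C) _.

Lemma mem_code_part w : (w \in code_part) = (map_mx hP w \in C).
Proof. by []. Qed.

Lemma code_part_proj v : v \in C -> map_mx gP v \in code_part.
Proof. by move=> Cv; rewrite mem_code_part (factor_mx_retract ghP) rpredZ. Qed.

(** R[z]^n / C retracts onto S[z]^n / C_S by the maps that [g] and [h] induce. *)
Lemma flat_code_part :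
  flat (restrict_scalars polyC (quotmod C)) ->
  flat (restrict_scalars polyC (quotmod code_part)).
Proof.
have gL := map_mx_semilinear gP n 1.
have hL := factor_mx_semilinear ghP n 1.
have gW : {homo map_mx gP : v / v \in C >-> v \in code_part}.
  exact: code_part_proj.
have hW : {homo map_mx hP : v / v \in code_part >-> v \in C} by [].
have gqL := semilinear_restrict (fun a => map_polyC g a)
  (quotmod_map_semilinear gL gW).
have hqL := semilinear_restrict (fun a => map_polyC h a)
  (quotmod_map_semilinear hL hW).
apply: (flat_semiretract (factorK gh) gqL hqL) => x.
rewrite -[x]quotmod_pi_repr (quotmod_mapE hL hW).
by rewrite (quotmod_mapE gL gW) (factor_mxK ghP).
Qed.

Lemma is_code_part k : is_code k C -> is_code k code_part.
Proof.
case=> kn [G [G_inj GC]] flatC; split=> //; last exact: flat_code_part.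
exists (map_mx gP G); split=> [u v uv|w].
  have /G_inj/(congr1 (map_mx gP)) : G *m map_mx hP u = G *m map_mx hP v.
    by rewrite -!(factor_mulmx ghP) uv.
  by rewrite !(factor_mxK ghP).
rewrite mem_code_part GC; split=> -[u wE].
  by exists (map_mx gP u); rewrite -map_mxM -wE (factor_mxK ghP).
by exists (map_mx hP u); rewrite wE (factor_mulmx ghP).
Qed.

End CodePart.

(** * The part of a representation over a factor *)

Section TriplePart.
Variables (R S : comNzRingType) (g : {rmorphism R -> S}) (n k d : nat).

Definition map_triple (X : for_triple R n k d) : for_triple S n k d :=
  let: (K, L, M) := X in (map_mx g K, map_mx g L, map_mx g M).

Lemma map_pencil (K L : 'M[R]_(d + n - k, d)) :
  map_mx (map_poly g) (pencil K L) = pencil (map_mx g K) (map_mx g L).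
Proof.
apply/matrixP => i j; rewrite !mxE rmorphD rmorphM /= map_polyX.
by rewrite !map_polyC.
Qed.

Lemma map_mx_polyC m r (A : 'M[R]_(m, r)) :
  map_mx (map_poly g) (map_mx polyC A) = map_mx polyC (map_mx g A).
Proof. by apply/matrixP => i j; rewrite !mxE map_polyC. Qed.

Variables (h : {additive S -> R}) (gh : factor g h).
Let ghP := factor_poly gh.

Lemma represents_part (C : submodClosed 'cV[{poly R}]_n)
    (X : for_triple R n k d) :
  represents C X -> represents (code_part gh C) (map_triple X).
Proof.
case: X => -[K L] M CX w; rewrite mem_code_part CX -map_pencil -map_mx_polyC.
split=> -[x xw].
  exists (map_mx (map_poly g) x).
  have := congr1 (map_mx (map_poly g)) xw.
  by rewrite map_mxD !map_mxM (factor_mxK ghP) map_mx0.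
exists (map_mx (map_poly h) x).
by rewrite -!(factor_mulmx ghP) -map_mxD xw map_mx0.
Qed.

(** Each condition over S is lifted to R by [h], where it holds, and brought back
by [g]; flatness of the cokernel is [flat_semiretract]. *)
Lemma minimal_part (X : for_triple R n k d) :
  minimal X -> minimal (map_triple X).
Proof.
case: X => -[K L] M [[K_inj K_flat] KM_surj P_surj]; split; first split.
- move=> u v uv.
  have /K_inj/(congr1 (map_mx g)) : K *m map_mx h u = K *m map_mx h v.
    by rewrite -!(factor_mulmx gh) uv.
  by rewrite !(factor_mxK gh).
- exact: (flat_coker_factor gh).
- move=> y; have [x xy] := KM_surj (map_mx h y); exists (map_mx g x).
  by rewrite -map_row_mx -map_mxM xy (factor_mxK gh).
- move=> y; have [x xy] := P_surj (map_mx (map_poly h) y).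
  exists (map_mx (map_poly g) x).
  by rewrite -map_pencil -map_mx_polyC -map_row_mx -map_mxM xy (factor_mxK ghP).
Qed.

End TriplePart.

(** * Residue fields and degrees *)

(** [u] identifies F with the fraction field of its image. *)
Definition fraction_map (R : comNzRingType) (F : fieldType) (u : R -> F) :=
  forall x, exists a b, u b != 0 /\ x = u a / u b.

(** u a / u b |-> v a / v b is well defined because equal kernels make [v]
constant on the fibers of [u]. *)
Lemma fraction_lift (R : comNzRingType) (F F' : fieldType)
    (u : {rmorphism R -> F}) (v : {rmorphism R -> F'}) :
  fraction_map u -> (forall a, u a = 0 <-> v a = 0) ->
  exists theta : {rmorphism F -> F'}, forall a, theta (u a) = v a.
Proof.
move=> uF uv.
have uv_neq0 a : u a != 0 -> v a != 0 by apply: contraNneq => /uv ->.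
have uv_eq a b : u a = u b -> v a = v b.
  move=> uab; apply/eqP; rewrite -subr_eq0 -rmorphB; apply/eqP/uv.
  by rewrite rmorphB uab subrr.
have [num numE] := choice uF; have [den denE] := choice numE.
pose th x := v (num x) / v (den x).
have thE a b : u b != 0 -> th (u a / u b) = v a / v b.
  move=> b0; have [d0 /eqP] := denE (u a / u b).
  rewrite eqr_div // -!rmorphM => /eqP/uv_eq.
  by rewrite !rmorphM => E; apply/eqP; rewrite eqr_div ?uv_neq0 // E.
have thB : zmod_morphism th.
  move=> x y; have [a [b [b0 ->]]] := uF x; have [c [d [d0 ->]]] := uF y.
  rewrite !thE // -!mulNr !addf_div ?uv_neq0 // -!rmorphN -!rmorphM -!rmorphD.
  by rewrite thE // rmorphM mulf_neq0.
have thM : monoid_morphism th.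
  split=> [|x y].
    by rewrite -[1]divr1 -[1](rmorph1 u) thE ?rmorph1 ?oner_eq0 // divr1.
  have [a [b [b0 ->]]] := uF x; have [c [d [d0 ->]]] := uF y.
  rewrite !thE // !mulf_div -!rmorphM thE //.
  by rewrite rmorphM mulf_neq0.
pose thZ := GRing.isZmodMorphism.Build F F' th thB.
pose thR := GRing.isMonoidMorphism.Build F F' th thM.
pose theta : {rmorphism F -> F'} := HB.pack th thZ thR.
exists theta => a; rewrite -[LHS]/(th _) -[u a]divr1 -(rmorph1 u).
by rewrite thE ?rmorph1 ?oner_eq0 // divr1.
Qed.

Lemma tofrac_fraction (D : idomainType) (x : {fraction D}) :
  exists n d : D, d != 0 /\ x = FracField.tofrac n / FracField.tofrac d.
Proof.
elim/quotW: x => x; exists (frac x).1, (frac x).2.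
have d0 := denom_ratioP x; split=> //.
apply: (mulIf (x := FracField.tofrac (frac x).2)); first by rewrite tofrac_eq0.
rewrite divfK ?tofrac_eq0 //; unlock FracField.tofrac.
rewrite -[LHS]FracField.pi_mul; apply/eqmodP => /=.
rewrite FracField.equivfE /FracField.mulf.
by rewrite !numden_Ratio ?mulf_neq0 ?oner_eq0 // !mulr1 mulrC.
Qed.

Section Residue.
Variables (R : comNzRingType) (p : prime_idealr R).

Lemma to_residue_eq0 a : to_residue p a = 0 <-> a \in (p : pred R).
Proof.
have := Quotient.idealrBE p a 0; rewrite subr0 => ->.
rewrite /to_residue /=; split=> [/eqP|/eqP a0].
  by rewrite tofrac_eq0 /residue_proj => /eqP ->; rewrite raddf0.
by apply/eqP; rewrite tofrac_eq0 /residue_proj a0 raddf0.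
Qed.

Lemma to_residue_fraction : fraction_map (to_residue p).
Proof.
move=> x; have [n [d [d0 ->]]] := tofrac_fraction x.
have projK y : residue_proj p (repr (y : {ideal_quot p})) = y by exact: reprK.
exists (repr (n : {ideal_quot p})), (repr (d : {ideal_quot p})).
by rewrite /to_residue /= !projK tofrac_eq0.
Qed.

End Residue.

Section PrimePullback.
Variables (R S : comNzRingType) (g : {rmorphism R -> S}) (p : prime_idealr S).

Definition pullback_pred : pred R := fun a => g a \in (p : pred S).

Lemma pullback_idealr : idealr_closed pullback_pred.
Proof.
split; rewrite -?topredE /= /pullback_pred ?rmorph0 ?rmorph1 ?idealr0
  ?idealr1 //.
move=> a u v; rewrite -!topredE /= /pullback_pred => pu pv.
by rewrite rmorphD rmorphM; apply: rpredD => //; apply: idealMr.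
Qed.
HB.instance Definition _ := isIdealr.Build R pullback_pred pullback_idealr.

Lemma pullback_prime : prime_idealr_closed pullback_pred.
Proof.
by move=> u v; rewrite -!topredE /= /pullback_pred rmorphM prime_idealrM.
Qed.
HB.instance Definition _ :=
  isPrimeIdealrClosed.Build R pullback_pred pullback_prime.

Definition pullback : prime_idealr R := PrimeIdealr.clone R pullback_pred _.

Lemma to_residue_pullback_eq0 a :
  to_residue pullback a = 0 <-> to_residue p (g a) = 0.
Proof. by rewrite !to_residue_eq0. Qed.

Variables (h : S -> R) (hK : cancel h g).

(** Both fields are generated as fields of fractions by the image of R, through
[to_residue pullback] and through [to_residue p] after [g], and the two maps
from R have the same kernel. *)
Lemma residue_field_iso :
  exists (th : {rmorphism residue_field pullback -> residue_field p})
    (th' : {rmorphism residue_field p -> residue_field pullback}),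
  [/\ forall a, th (to_residue pullback a) = to_residue p (g a),
      forall a, th' (to_residue p (g a)) = to_residue pullback a,
      cancel th th' & cancel th' th].
Proof.
pose u := to_residue pullback.
pose v : {rmorphism R -> residue_field p} := to_residue p \o g.
have uF : fraction_map u by exact: to_residue_fraction.
have vF : fraction_map v.
  move=> x; have [a [b [b0 ->]]] := to_residue_fraction x.
  by exists (h a), (h b); rewrite /v /= !hK.
have uv a : u a = 0 <-> v a = 0 by exact: to_residue_pullback_eq0.
have [th thE] := fraction_lift uF uv.
have [th' thE'] := fraction_lift vF (fun a => iff_sym (uv a)).
exists th, th'; split=> // x.
  have [a [b [_ ->]]] := uF x; rewrite !fmorph_div !thE.
  by rewrite -!/(v _) !thE'.
have [a [b [_ ->]]] := vF x; rewrite !fmorph_div !thE'.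
by rewrite !thE.
Qed.

End PrimePullback.

(** [th] need not come from a morphism R -> R': this allows the inverse of the
isomorphism of residue fields, which goes from the factor to the product. *)
Lemma code_fiber_map (R R' : comNzRingType) (n : nat) (p : prime_idealr R)
    (p' : prime_idealr R')
    (C : submodClosed 'cV[{poly R}]_n) (C' : submodClosed 'cV[{poly R'}]_n)
    (th : {rmorphism residue_field p -> residue_field p'}) v :
  (forall c, c \in C -> exists2 c', c' \in C' &
     map_mx (map_poly (to_residue p')) c' =
     map_mx (map_poly th) (map_mx (map_poly (to_residue p)) c)) ->
  code_fiber C v -> code_fiber C' (map_mx (map_poly th) v).
Proof.
move=> CC' [r [a [c [Cc ->]]]].
have /choice[c' c'P] i : exists c', c' \in C' /\
     map_mx (map_poly (to_residue p')) c' =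
     map_mx (map_poly th) (map_mx (map_poly (to_residue p)) (c i)).
  by have [c' ? ?] := CC' _ (Cc i); exists c'.
exists r, (th \o a), c'; split=> [i|]; first by case: (c'P i).
rewrite raddf_sum; apply: eq_bigr => i _.
by rewrite /= map_mxZ (c'P i).2; congr (_ *: _); apply: map_polyC.
Qed.

Lemma max_minor_degree_map (F F' : fieldType) (th : {rmorphism F -> F'}) n k
    (G : 'M[{poly F}]_(n, k)) :
  max_minor_degree (map_mx (map_poly th) G) = max_minor_degree G.
Proof.
apply: eq_bigr => f _.
have -> : rowsub f (map_mx (map_poly th) G) = map_mx (map_poly th) (rowsub f G).
  by apply/matrixP => i j; rewrite !mxE.
by rewrite det_map_mx size_map_poly.
Qed.

Section CodePartDegree.
Variables (R S : comNzRingType).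
Variables (g : {rmorphism R -> S}) (h : {additive S -> R}).
Hypothesis gh : factor g h.

(** The isomorphism between the residue fields at [p] and its preimage carries
the fiber of C to the fiber of its part, hence generators of the second to
generators of the first, without changing the degrees of their minors. *)
Lemma code_degree_part n k d (C : submodClosed 'cV[{poly R}]_n) :
  code_degree k C d -> code_degree k (code_part gh C) d.
Proof.
move=> Cd p G GC; have ghP := factor_poly gh.
have [th [th' [thE thE' thK thK']]] := residue_field_iso p (factorK gh).
have redE m (A : 'M[{poly R}]_(n, m)) :
    map_mx (map_poly th) (map_mx (map_poly (to_residue (pullback g p))) A) =
    map_mx (map_poly (to_residue p)) (map_mx (map_poly g) A).
  by apply/matrixP => i j; rewrite !mxE -!map_poly_comp; apply: eq_map_poly.
have mapK m1 m2 :
    cancel (@map_mx _ _ (map_poly th) m1 m2) (map_mx (map_poly th')).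
  by move=> A; apply/matrixP => i j; rewrite !mxE (map_polyK thK) ?rmorph0.
have mapK' m1 m2 :
    cancel (@map_mx _ _ (map_poly th') m1 m2) (map_mx (map_poly th)).
  by move=> A; apply/matrixP => i j; rewrite !mxE (map_polyK thK') ?rmorph0.
rewrite -(max_minor_degree_map th' G); apply: Cd => v.
have fiberE : code_fiber C v <->
    code_fiber (code_part gh C) (map_mx (map_poly th) v).
  split=> [|Cv].
    apply: code_fiber_map => c Cc; exists (map_mx (map_poly g) c) => //.
    exact: code_part_proj.
  rewrite -[v]mapK; apply: code_fiber_map Cv => c Cc.
  exists (map_mx (map_poly h) c) => //.
  by rewrite -[LHS]mapK redE (factor_mxK ghP).
rewrite fiberE GC; split=> -[u uE].
  by exists (map_mx (map_poly th') u); rewrite -map_mxM -uE mapK.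
by exists (map_mx (map_poly th) u); rewrite uE map_mxM mapK'.
Qed.

End CodePartDegree.

(** * Gluing over a product *)

(** A is the product of the B i with projections [f i]. *)
Definition jointly_bijective (I : Type) (A : Type) (B : I -> Type)
    (f : forall i, A -> B i) : Prop :=
  (forall x y, (forall i, f i x = f i y) -> x = y) /\
  (forall b : (forall i, B i), exists x, forall i, f i x = b i).

Lemma jointly_bijective_mx (I : Type) (A : Type) (B : I -> Type)
    (f : forall i, A -> B i) m n :
  jointly_bijective f -> jointly_bijective (fun i => @map_mx _ _ (f i) m n).
Proof.
case=> f_inj f_surj; split=> [x y xy|b].
  by apply/matrixP => i j; apply: f_inj => l;
    have /matrixP/(_ i j) := xy l; rewrite !mxE.
have /choice[c cE] (ij : 'I_m * 'I_n) :
    exists x, forall i, f i x = b i ij.1 ij.2.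
  exact: f_surj.
by exists (\matrix_(i, j) c (i, j)) => l; apply/matrixP => i j; rewrite !mxE cE.
Qed.

(** Gluing coefficients gives a polynomial because finitely many polynomials
have a common bound on their sizes. *)
Lemma jointly_bijective_poly (I : finType) (R : comNzRingType)
    (S : I -> comNzRingType) (g : forall i, {rmorphism R -> S i}) :
  jointly_bijective (fun i => g i : R -> S i) ->
  jointly_bijective (fun i => map_poly (g i)).
Proof.
case=> g_inj g_surj; split=> [p q pq|b].
  by apply/polyP => n; apply: g_inj => i; rewrite -!coef_map pq.
have /choice[c cE] n : exists x, forall i, g i x = (b i)`_n by exact: g_surj.
exists (\poly_(n < \max_i size (b i)) c n) => i; apply/polyP => n.
rewrite coef_map coef_poly; case: ltnP => [_|le_n]; first exact: cE.
rewrite raddf0 nth_default //; apply: leq_trans le_n.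
exact: (leq_bigmax (F := fun i => size (b i))).
Qed.

Section ProductDescent.
Variables (I : finType) (R : comNzRingType) (S : I -> comNzRingType).
Variable g : forall i, {rmorphism R -> S i}.
Variable h : forall i, {additive S i -> R}.
Hypotheses (gh : forall i, factor (g i) (h i)) (h1 : \sum_i h i 1 = 1).
Hypothesis g_bij : jointly_bijective (fun i => g i : R -> S i).
Variables (n k d : nat).
Let gP_bij := jointly_bijective_poly g_bij.

(** v is the sum of the h_i (g_i v), which lie in C when the g_i v lie in the
parts of C. *)
Lemma mem_code_parts (C : submodClosed 'cV[{poly R}]_n) v :
  v \in C <-> forall i, map_mx (map_poly (g i)) v \in code_part (gh i) C.
Proof.
split=> [Cv i|Cv]; first exact: code_part_proj.
suff -> : v = \sum_i map_mx (map_poly (h i)) (map_mx (map_poly (g i)) v).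
  by apply: rpred_sum => i _; apply: Cv.
have -> : \sum_i map_mx (map_poly (h i)) (map_mx (map_poly (g i)) v) =
          \sum_i map_poly (h i) 1 *: v.
  by apply: eq_bigr => i _; rewrite (factor_mx_retract (factor_poly (gh i))).
rewrite -scaler_suml -[LHS]scale1r; congr (_ *: _).
rewrite -[LHS]/(1%:P) -h1 raddf_sum; apply: eq_bigr => i _.
by rewrite -[1 in RHS]/(1%:P) map_polyC.
Qed.

(** A witness x of v in Ker(zK + L | M) is glued from witnesses for the g_i v. *)
Lemma represents_glue (C : submodClosed 'cV[{poly R}]_n)
    (X : for_triple R n k d) :
  (forall i, represents (code_part (gh i) C) (map_triple (g i) X)) ->
  represents C X.
Proof.
case: X => -[K L] M CX v; rewrite mem_code_parts; split=> [Cv|[x xv] i].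
  have /= xP i := (CX i _).1 (Cv i).
  pose b i := projT1 (cid (xP i)); have bE i := projT2 (cid (xP i)).
  have [x xE] := (jointly_bijective_mx d 1 gP_bij).2 b; exists x.
  apply: (jointly_bijective_mx _ _ gP_bij).1 => i.
  rewrite map_mxD !map_mxM map_pencil map_mx_polyC xE /= map_mx0.
  exact: bE.
apply/(CX i); exists (map_mx (map_poly (g i)) x).
by rewrite -map_pencil -map_mx_polyC -!map_mxM -map_mxD xv map_mx0.
Qed.

Lemma minimal_glue (X : for_triple R n k d) :
  (forall i, minimal (map_triple (g i) X)) -> minimal X.
Proof.
case: X => -[K L] M Xm; split; first split.
- move=> u v uv; apply: (jointly_bijective_mx _ _ g_bij).1 => i.
  by have [[K_inj _] _ _] := Xm i; apply: K_inj; rewrite -!map_mxM uv.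
- by apply: (flat_coker_product gh h1) => i; have [[]] := Xm i.
- move=> y.
  have xP i : exists x : 'cV_(d + n),
      row_mx (map_mx (g i) K) (map_mx (g i) M) *m x = map_mx (g i) y.
    by have [_ KM_surj _] := Xm i; apply: KM_surj.
  have [x xE] := (jointly_bijective_mx (d + n) 1 g_bij).2
    (fun i => projT1 (cid (xP i))).
  exists x; apply: (jointly_bijective_mx _ _ g_bij).1 => i.
  by rewrite map_mxM map_row_mx xE; apply: projT2 (cid (xP i)).
- move=> y.
  have xP i : exists x : 'cV_(d + n),
      row_mx (pencil (map_mx (g i) K) (map_mx (g i) L))
        (map_mx polyC (map_mx (g i) M)) *m x = map_mx (map_poly (g i)) y.
    by have [_ _ P_surj] := Xm i; apply: P_surj.
  have [x xE] := (jointly_bijective_mx (d + n) 1 gP_bij).2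
    (fun i => projT1 (cid (xP i))).
  exists x; apply: (jointly_bijective_mx _ _ gP_bij).1 => i.
  rewrite map_mxM map_row_mx map_pencil map_mx_polyC xE.
  exact: projT2 (cid (xP i)).
Qed.

Lemma triple_glue (Y : forall i, for_triple (S i) n k d) :
  exists X : for_triple R n k d, forall i, map_triple (g i) X = Y i.
Proof.
have [K KE] := (jointly_bijective_mx _ _ g_bij).2 (fun i => (Y i).1.1).
have [L LE] := (jointly_bijective_mx _ _ g_bij).2 (fun i => (Y i).1.2).
have [M ME] := (jointly_bijective_mx _ _ g_bij).2 (fun i => (Y i).2).
by exists (K, L, M) => i; rewrite /= KE LE ME; case: (Y i) => -[].
Qed.

Lemma equivalent_glue (X X' : for_triple R n k d) :
  (forall i, equivalent (map_triple (g i) X) (map_triple (g i) X')) ->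
  equivalent X X'.
Proof.
case: X => -[K L] M; case: X' => -[K' L'] M' XX'.
have mx_inj m r := (@jointly_bijective_mx _ _ _ _ m r g_bij).1.
have QP i : exists Q : 'M[S i]_(d + n - k) * 'M[S i]_(d + n - k) *
    'M[S i]_d * 'M[S i]_d, let: (T, T', U, U') := Q in
    [/\ inverse_mx T T', inverse_mx U U' &
        (map_mx (g i) K', map_mx (g i) L', map_mx (g i) M') =
        (T *m map_mx (g i) K *m U', T *m map_mx (g i) L *m U',
         T *m map_mx (g i) M)].
  by have [T [T' [U [U' TU]]]] := XX' i; exists (T, T', U, U').
pose Q i := projT1 (cid (QP i)).
have [T TE] := (jointly_bijective_mx _ _ g_bij).2 (fun i => (Q i).1.1.1).
have [T' TE'] := (jointly_bijective_mx _ _ g_bij).2 (fun i => (Q i).1.1.2).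
have [U UE] := (jointly_bijective_mx _ _ g_bij).2 (fun i => (Q i).1.2).
have [U' UE'] := (jointly_bijective_mx _ _ g_bij).2 (fun i => (Q i).2).
have TUP i : [/\ inverse_mx (map_mx (g i) T) (map_mx (g i) T'),
    inverse_mx (map_mx (g i) U) (map_mx (g i) U') &
    [/\ map_mx (g i) K' = map_mx (g i) (T *m K *m U'),
        map_mx (g i) L' = map_mx (g i) (T *m L *m U') &
        map_mx (g i) M' = map_mx (g i) (T *m M)]].
  rewrite !map_mxM TE TE' UE UE' /Q; case: (cid (QP i)) => /= -[[[? ?] ?] ?].
  by case=> ? ? [-> -> ->].
exists T, T', U, U'; split.
- by split; apply: mx_inj => i; rewrite map_mxM map_mx1;
    have [[TT' T'T] _ _] := TUP i.
- by split; apply: mx_inj => i; rewrite map_mxM map_mx1;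
    have [_ [UU' U'U] _] := TUP i.
- by congr (_, _, _); apply: mx_inj => i; have [_ _ []] := TUP i.
Qed.

End ProductDescent.

Lemma ring_with_representations_product (I : finType) (R : comNzRingType)
    (S : I -> comNzRingType) (g : forall i, {rmorphism R -> S i})
    (h : forall i, {additive S i -> R}) :
  (forall i, factor (g i) (h i)) -> \sum_i h i 1 = 1 ->
  jointly_bijective (fun i => g i : R -> S i) ->
  (forall i, ring_with_representations (S i)) -> ring_with_representations R.
Proof.
move=> gh h1 g_bij S_rep n k d C C_code Cd.
have Ci_rep i := S_rep i n k d (code_part (gh i) C)
  (is_code_part (gh i) C_code) (code_degree_part (gh := gh i) Cd).
split=> [|X X' CX Xm CX' Xm'].
  have [X XE] := triple_glue g_bij (fun i => projT1 (cid (Ci_rep i).1)).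
  have XP i : represents (code_part (gh i) C) (map_triple (g i) X) /\
              minimal (map_triple (g i) X).
    by rewrite XE; apply: projT2 (cid (Ci_rep i).1).
  exists X; split.
    by apply: (represents_glue (gh := gh) h1 g_bij) => i; case: (XP i).
  by apply: (minimal_glue gh h1 g_bij) => i; case: (XP i).
apply: (equivalent_glue g_bij) => i.
by apply: (Ci_rep i).2; [exact: represents_part|exact: (minimal_part (gh i))
  |exact: represents_part|exact: (minimal_part (gh i))].
Qed.

(** * The ring of families *)

Section ProdRing.
Variables (t : nat) (R : 'I_t.+1 -> comNzRingType).
Variable j : 'I_t.+1.

Definition prod_proj (x : prod_ring R) : R j := x j.

Lemma prod_proj_zmod : zmod_morphism prod_proj.
Proof. by move=> x y; rewrite /prod_proj !prod_mkE. Qed.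
HB.instance Definition _ := GRing.isZmodMorphism.Build (prod_ring R) (R j)
  prod_proj prod_proj_zmod.

Lemma prod_proj_monoid : monoid_morphism prod_proj.
Proof. by split=> [|x y]; rewrite /prod_proj !prod_mkE. Qed.
HB.instance Definition _ := GRing.isMonoidMorphism.Build (prod_ring R) (R j)
  prod_proj prod_proj_monoid.

Definition prod_inj (a : R j) : prod_ring R :=
  prod_mk (dfwith (fun i => 0 : R i) a).

Lemma prod_injE a : prod_inj a j = a.
Proof. by rewrite prod_mkE dfwith_in. Qed.

Lemma prod_inj_out a i : j != i -> prod_inj a i = 0.
Proof. by move=> ji; rewrite prod_mkE dfwith_out. Qed.

Lemma prod_inj_zmod : zmod_morphism prod_inj.
Proof.
move=> a b; apply/ffunP => i; rewrite !prod_mkE.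
have [<-|ji] := eqVneq j i; first by rewrite !dfwith_in.
by rewrite !dfwith_out // subr0.
Qed.
HB.instance Definition _ := GRing.isZmodMorphism.Build (R j) (prod_ring R)
  prod_inj prod_inj_zmod.

Lemma prod_factor : factor prod_proj prod_inj.
Proof.
split=> [a|x b]; first exact: prod_injE.
apply/ffunP => i; rewrite [RHS]prod_mkE.
have [<-|ji] := eqVneq j i; first by rewrite !prod_injE.
by rewrite !prod_inj_out // mulr0.
Qed.

End ProdRing.
Arguments prod_proj {t} R j x.
Arguments prod_inj {t} R j a.

Lemma sum_prod_inj1 (t : nat) (R : 'I_t.+1 -> comNzRingType) :
  \sum_j prod_inj R j 1 = 1.
Proof.
apply/ffunP => i; rewrite -[LHS]/(prod_proj R i _) raddf_sum (bigD1 i) //=.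
rewrite big1 ?addr0 => [|j ji]; rewrite /prod_proj ?prod_injE ?prod_inj_out //.
by rewrite prod_mkE.
Qed.

Lemma prod_proj_jointly_bijective (t : nat) (R : 'I_t.+1 -> comNzRingType) :
  jointly_bijective (prod_proj R).
Proof.
split=> [x y xy|b]; first exact/ffunP.
by exists (prod_mk b) => i; rewrite /prod_proj prod_mkE.
Qed.

Theorem theorem3p14 (t : nat) (R : 'I_t.+1 -> comNzRingType) :
  (forall j : 'I_t.+1, ring_with_representations (R j)) ->
  ring_with_representations (prod_ring R).
Proof.
exact: (ring_with_representations_product (prod_factor R) (sum_prod_inj1 R)
  (prod_proj_jointly_bijective R)).
Qed.
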